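(* Let $f:\mathbb{N}\to\mathbb{C}$ be an arbitrary arithmetic function, let $k\ge 2$ be an integer, and assume that the series $\sum_{n=1}^{\infty}\frac{f(n)}{n^k}$ is absolutely convergent. Then $$\lim_{x\to\infty}\frac{1}{x(\log x)^{k-1}}\sum_{n_1\cdots n_k\le x}f((n_1,\ldots,n_k))=\frac{1}{(k-1)!\,\zeta(k)}\sum_{n=1}^{\infty}\frac{f(n)}{n^k},$$ where the sum on the left is over all $(n_1,\ldots,n_k)\in\mathbb{N}^k$ with $n_1\cdots n_k\le x$.
   Context: $\mathbb{N}=\{1,2,\ldots\}$; $(n_1,\ldots,n_k)$ inside $f$ denotes the greatest common divisor of $n_1,\ldots,n_k$; $\zeta$ is the Riemann zeta function. *)

(* Defs.v *)
From mathcomp Require Import all_boot all_order all_algebra.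
From mathcomp Require Import complex.
From mathcomp Require Import all_classical all_reals all_analysis.

Set Implicit Arguments.
Unset Strict Implicit.
Unset Printing Implicit Defensive.

Import Order.TTheory GRing.Theory Num.Theory numFieldNormedType.Exports.

Local Open Scope classical_set_scope.
Local Open Scope complex_scope.
Local Open Scope ring_scope.

(* The Riemann zeta function at a real argument s > 1, where it is given by its
   Dirichlet series. *)
Definition zeta (R : realType) (s : R) : R :=
  limn (series (fun n => (n.+1%:R `^ s)^-1)).

(* This set is finite for every x (each n i is at most the product), so that
   \sum_(n \in hyperbolic k x) F n is an ordinary finite sum and never takes the
   default value of sums with infinite support. *)
Definition hyperbolic (R : realType) (k : nat) (x : R) :
    set {ffun 'I_k -> nat} :=
  [set n : {ffun 'I_k -> nat} |
    (forall i, (0 < n i)%N) /\ (\prod_(i < k) n i)%N%:R <= x].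

Arguments hyperbolic {R} k x.

Definition gcd_tuple (k : nat) (n : {ffun 'I_k -> nat}) : nat :=
  (\big[gcdn/0]_(i < k) n i)%N.

(* Main.v *)
(* Let P(y) count the k-tuples of positive integers with product at most y and
   gcd 1, and D(y) those with product at most y.  Dividing a tuple by its gcd
   gives \sum f(gcd) = \sum_e f(e) P(x / e^k), and D(y) = \sum_e P(y / e^k) when
   f = 1.  Induction on k, with D_(k+1)(y) = \sum_(n <= y) D_k(y / n), yields
   D(y) = y ln^(k-1) y / (k-1)! + O(y (1 + ln y)^(k-2)).  Instead of inverting the
   relation between D and P with the Moebius function, one subtracts from P its
   expected main term c y ln^(k-1) y, c = 1 / ((k-1)! zeta(k)): the remainder h
   satisfies \sum_e h(y / e^k) = O(y (1 + ln y)^(k-2)), and since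
   \sum_(e >= 2) e^(-k) < 1 this forces h itself to be of that order.  Hence
   P(x / n^k) n^k / (x ln^(k-1) x) tends to c boundedly, and dominated
   convergence (Tannery) against the summable f(n) / n^k concludes. *)

Require Import Defs.
From mathcomp Require Import all_boot all_order all_algebra.
From mathcomp Require Import complex.
From mathcomp Require Import all_classical all_reals all_analysis.
From mathcomp Require Import ring lra zify.

Set Implicit Arguments.
Unset Strict Implicit.
Unset Printing Implicit Defensive.

Import Order.TTheory GRing.Theory Num.Theory numFieldNormedType.Exports.

(** * Enumeration of the tuples with bounded product *)

(** For integers, [n * p <= m] iff [p <= m %/ n], so rounding the bound at each entry loses nothing.
    The empty product is 1, which is why the bound 0 must exclude even the empty tuple. *)
Fixpoint hyptuples (k m : nat) : seq (seq nat) :=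
  if k is k'.+1 then
    [seq n :: t | n <- iota 1 m, t <- hyptuples k' (m %/ n)]
  else if (0 < m)%N then [:: [::]] else [::].

Lemma prodn_muln (e : nat) (t : seq nat) :
  (\prod_(n <- map (muln e) t) n = e ^ size t * \prod_(n <- t) n)%N.
Proof.
rewrite big_map; elim: t => [|n t IH] /=; first by rewrite !big_nil.
by rewrite !big_cons IH expnS; lia.
Qed.

Lemma mem_hyptuples k m t : (t \in hyptuples k m) =
  [&& size t == k, all (leq 1) t & (0 < \prod_(n <- t) n <= m)%N].
Proof.
elim: k m t => [|k IH] m t /=.
  by case: t => [|n t]; case: m => [|m] //=; rewrite ?big_nil // mem_seq1.
apply/allpairsPdep/idP => [[n [s [+ + ->]]]|].
  rewrite mem_iota IH => n1 /and3P[/eqP <- s0 /andP[p0 pm]].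
  rewrite /= eqxx big_cons muln_gt0 p0 s0 /= andbT.
  have n0 : (0 < n)%N by case/andP: n1.
  by rewrite n0 /= mulnC -leq_divRL.
case: t => [//|n s] /= /and3P[/eqP[sk] /andP[n0 s0]].
rewrite big_cons muln_gt0 => /andP[/andP[_ p0] pm].
exists n, s; split => //.
  rewrite mem_iota n0 add1n ltnS (leq_trans _ pm) //.
  by rewrite -{1}(muln1 n) leq_mul2l p0 orbT.
by rewrite IH sk eqxx s0 p0 /= leq_divRL // mulnC.
Qed.

Lemma hyptuples_uniq k m : uniq (hyptuples k m).
Proof.
elim: k m => [|k IH] m /=; first by case: m.
apply: allpairs_uniq_dep => [|n _|[n1 t1] [n2 t2] _ _ /= [-> ->]] //.
exact: iota_uniq.
Qed.

Lemma size_hyptuplesS k m :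
  size (hyptuples k.+1 m) = (\sum_(1 <= n < m.+1) size (hyptuples k (m %/ n)))%N.
Proof.
rewrite /= size_allpairs_dep sumnE big_map /index_iota subn1 //.
Qed.

Lemma size_hyptuples1 m : size (hyptuples 1 m) = m.
Proof.
rewrite size_hyptuplesS (eq_big_nat _ _ (F2 := fun=> 1%N)); last first.
  by move=> n /andP[n0 nm] /=; rewrite divn_gt0 // -ltnS nm.
by rewrite sum_nat_const_nat muln1 subn1.
Qed.

(** * Sorting tuples by their gcd *)

Definition gcdseq (t : seq nat) := foldr gcdn 0%N t.

Lemma gcdseq_muln e t : gcdseq (map (muln e) t) = (e * gcdseq t)%N.
Proof. by elim: t => [|n t IH] /=; rewrite ?muln0 // IH muln_gcdr. Qed.

Lemma dvdn_gcdseq t : all (dvdn (gcdseq t)) t.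
Proof.
elim: t => [//|n t IH] /=; rewrite dvdn_gcdl /=.
by apply: sub_all IH => x; apply: dvdn_trans; rewrite dvdn_gcdr.
Qed.

Definition primtuples k m :=
  count (fun t => gcdseq t == 1%N) (hyptuples k m).

Lemma primtuples0 k : primtuples k 0 = 0%N.
Proof. by case: k. Qed.

(** Multiplying all entries by [e] multiplies the gcd by [e] and the product by [e ^ k]; it is a
    bijection from the primitive tuples onto those of gcd [e]. *)
Lemma count_gcdseq k m e : (0 < k)%N -> (0 < e)%N ->
  count (fun t => gcdseq t == e) (hyptuples k m) = primtuples k (m %/ e ^ k).
Proof.
move=> k0 e0; rewrite /primtuples -!size_filter -[RHS](size_map (map (muln e))).
apply/perm_size/uniq_perm; first by rewrite filter_uniq // hyptuples_uniq.
  rewrite map_inj_uniq ?filter_uniq ?hyptuples_uniq //.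
  by apply: inj_map => x y /eqP; rewrite eqn_pmul2l // => /eqP.
have ek0 : (0 < e ^ k)%N by rewrite expn_gt0 e0.
move=> t; rewrite mem_filter; apply/andP/mapP => [[/eqP ge]|[s]].
  rewrite mem_hyptuples => /and3P[/eqP st t0 /andP[p0 pm]].
  have tE : t = map (muln e) (map (divn^~ e) t).
    rewrite -map_comp -[LHS]map_id; apply/eq_in_map => n nt /=.
    by rewrite mulnC divnK // -ge; apply: (allP (dvdn_gcdseq t)).
  move: (map _ t) tE => s tE; subst t; exists s => //.
  move: ge st t0 p0 pm; rewrite gcdseq_muln prodn_muln size_map.
  move=> /eqP; rewrite -{2}(muln1 e) eqn_pmul2l // => gs st.
  rewrite st all_map muln_gt0 => s0 /andP[_ p0] pm.
  rewrite mem_filter gs mem_hyptuples st eqxx p0 leq_divRL // mulnC pm andbT.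
  rewrite andbT /=; apply/allP => n ns; have := allP s0 _ ns; rewrite /= muln_gt0.
  by case/andP.
rewrite mem_filter => /andP[/eqP gs +] ->; rewrite gcdseq_muln gs muln1 eqxx.
rewrite mem_hyptuples => /and3P[/eqP ss s0 /andP[p0 pm]]; split=> //.
rewrite mem_hyptuples size_map ss eqxx prodn_muln ss muln_gt0 ek0 p0 /=.
rewrite mulnC -leq_divRL // pm andbT all_map.
by apply: sub_all s0 => n /= n0; rewrite muln_gt0 e0.
Qed.

Local Open Scope classical_set_scope.
Local Open Scope complex_scope.
Local Open Scope ring_scope.

(** The range may extend beyond [m], where the counts vanish; later [M] is taken so large that a
    series over [e] is also close to its limit. *)
Lemma sum_gcdseq (V : nmodType) (F : nat -> V) k m M : (0 < k)%N -> (m <= M)%N ->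
  \sum_(t <- hyptuples k m) F (gcdseq t) =
  \sum_(1 <= e < M.+1) F e *+ primtuples k (m %/ e ^ k).
Proof.
move=> k0 mM.
have step t : t \in hyptuples k m ->
    F (gcdseq t) = \sum_(1 <= e < M.+1) (if gcdseq t == e then F e else 0).
  rewrite mem_hyptuples => /and3P[/eqP st t0 /andP[p0 pm]].
  rewrite -big_mkcond /=.
  (* As [0 < k] there is an entry; the gcd divides it, hence is positive and at most the product. *)
  have [n nt] : exists n, n \in t.
    by case: t st {t0 p0 pm} k0 => [/= <-|n t _ _] //; exists n; rewrite mem_head.
  have n0 := allP t0 _ nt; have gn := allP (dvdn_gcdseq t) _ nt.
  have g0 : (0 < gcdseq t)%N by apply: dvdn_gt0 gn.
  have nm : (n <= m)%N.
    by apply: leq_trans pm; apply: dvdn_leq => //; rewrite (big_rem n) //= dvdn_mulr.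
  rewrite (eq_bigl (pred1 (gcdseq t))); last by move=> e; rewrite /= eq_sym.
  rewrite -big_filter filter_pred1_uniq ?iota_uniq ?big_seq1 //.
  by rewrite mem_index_iota g0 ltnS (leq_trans _ mM) // (leq_trans _ nm) // dvdn_leq.
rewrite (eq_big_seq _ step) exchange_big /=.
apply: eq_big_nat => e /andP[e0 _].
rewrite -big_mkcond /= big_const_seq -count_gcdseq //.
by rewrite iter_addr_0 ; congr (_ *+ _); apply: eq_count => t; rewrite eq_sym.
Qed.

(** Listing the values of a function inverts [ff] on lists of length [k], so the set of tuples is
    the image of a duplicate-free list. *)
Lemma fsum_hyperbolic (R : realType) (V : nmodType) (F : nat -> V) k (x : R) :
  \sum_(n \in hyperbolic k x) F (gcd_tuple n) =
  \sum_(t <- hyptuples k (Num.truncn x)) F (gcdseq t).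
Proof.
pose ff (t : seq nat) := [ffun i : 'I_k => nth 0%N t i].
have codomK (n : {ffun 'I_k -> nat}) : ff (map n (enum 'I_k)) = n.
  by apply/ffunP => i; rewrite ffunE (nth_map i) ?size_enum_ord // nth_ord_enum.
have ffK t : size t = k -> map (ff t) (enum 'I_k) = t.
  move=> st; apply: (@eq_from_nth _ 0%N) => [|i]; rewrite size_map size_enum_ord //.
  move=> ik; rewrite (nth_map (Ordinal ik)) ?size_enum_ord // ffunE.
  by rewrite (_ : nth _ _ _ = Ordinal ik) //; exact: (nth_ord_enum _ (Ordinal ik)).
have prodE (n : {ffun 'I_k -> nat}) :
    (\prod_(m <- map n (enum 'I_k)) m = \prod_(i < k) n i)%N.
  by rewrite big_map big_enum.
have hypE : hyperbolic k x = [set` map ff (hyptuples k (Num.truncn x))].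
  apply/seteqP; split=> n /=.
    move=> [n0 nx]; apply/mapP; exists (map n (enum 'I_k)); last by rewrite codomK.
    rewrite mem_hyptuples size_map size_enum_ord eqxx all_map prodE /=.
    have p0 : (0 < \prod_(i < k) n i)%N by apply: prodn_gt0.
    (* The product is written as a successor because [truncn_gt_nat] holds for every real [x],
       negative ones included. *)
    rewrite p0 -[leqLHS](prednK p0) truncn_gt_nat prednK // nx andbT.
    by rewrite andbT; apply/allP => i _ /=.
  move=> /mapP[t +] ->; rewrite mem_hyptuples => /and3P[/eqP st t0 /andP[p0 px]].
  have pE : (\prod_(i < k) ff t i = \prod_(n <- t) n)%N.
    by rewrite -prodE ffK.
  split=> [i|].
    by rewrite ffunE; apply: (allP t0); rewrite mem_nth // st.
  by rewrite pE -(prednK p0) -truncn_gt_nat prednK.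
rewrite hypE -fsbig_seq; last first.
  rewrite map_inj_in_uniq ?hyptuples_uniq // => s t.
  rewrite !mem_hyptuples => /andP[/eqP ss _] /andP[/eqP st _] st_eq.
  by rewrite -(ffK s ss) -(ffK t st) st_eq.
rewrite big_map; apply: eq_big_seq => t.
rewrite mem_hyptuples => /andP[/eqP st _]; congr F.
by rewrite /gcd_tuple /gcdseq foldrE -[in RHS](ffK t st) big_map big_enum.
Qed.

(** * Sums of powers of a truncated logarithm *)

Section Analysis.
Variable R : realType.
Implicit Types (x y : R) (j k n : nat).

(** A mean value inequality: after factoring out [a - b], each of the [j.+1] remaining terms lies
    between [b ^+ j] and [a ^+ j]. *)
Lemma subrX_le (a b : R) j : 0 <= b -> b <= a ->
  (a - b) * (j.+1%:R * b ^+ j) <= a ^+ j.+1 - b ^+ j.+1 <=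
  (a - b) * (j.+1%:R * a ^+ j).
Proof.
move=> b0 ba; have a0 := le_trans b0 ba.
have cE (c : R) : j.+1%:R * c = \sum_(i < j.+1) c.
  by rewrite sumr_const card_ord mulr_natl.
rewrite subrXX !cE; apply/andP; split; apply: ler_wpM2l; rewrite ?subr_ge0 //;
  apply: ler_sum => i _ /=; have ij : (i <= j)%N by rewrite -ltnS.
  by rewrite -[X in b ^+ X <= _](subnK ij) exprD ler_wpM2r ?exprn_ge0 ?lerXn2r.
by rewrite -[X in _ <= a ^+ X](subnK ij) exprD ler_wpM2l ?exprn_ge0 ?lerXn2r.
Qed.

(* Truncating ln at 0 makes y * lnp y ^+ j vanish for y <= 1, as the counting
   functions do for y < 1, so that sums over e may run past the range e ^ k <= y. *)
Definition lnp y : R := Num.max 0 (ln y).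

Lemma lnp_ge0 y : 0 <= lnp y. Proof. by rewrite le_max lexx. Qed.

Lemma lnpE y : 1 <= y -> lnp y = ln y.
Proof. by move=> y1; apply/max_idPr/ln_ge0. Qed.

Lemma lnp_eq0 y : y <= 1 -> lnp y = 0.
Proof. by move=> y1; apply/max_idPl/ln_le0. Qed.

Lemma ler_lnp x y : 0 < x -> x <= y -> lnp x <= lnp y.
Proof.
by move=> x0 xy; rewrite ge_max lnp_ge0 le_max ler_ln ?posrE ?xy ?orbT //; apply: lt_le_trans xy.
Qed.

(** Truncation at 0 is monotone and 1-Lipschitz, and the untruncated difference is exactly
    [ln q]. *)
Lemma lnp_sub_div x (q : R) : 0 < x -> 1 <= q -> 0 <= lnp x - lnp (x / q) <= ln q.
Proof.
move=> x0 q1; have q0 : 0 < q by lra.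
rewrite subr_ge0 ler_lnp ?divr_gt0 //=; last by rewrite ler_pdivrMr // ler_peMr // ltW.
rewrite lerBlDl {1}/lnp ge_max addr_ge0 ?lnp_ge0 ?ln_ge0 //=.
rewrite -lerBlDr -ln_div ?posrE //; by rewrite /lnp le_max lexx orbT.
Qed.

(** Both bounds come from ln (1 + t) <= t, at t = - 1 / (n + 1) and at t = 1 / n. *)
Lemma lnSn_bounds n : (0 < n)%N ->
  n.+1%:R^-1 <= ln (n.+1%:R / n%:R : R) <= n%:R^-1.
Proof.
move=> n0; have n0R : 0 < n%:R :> R by rewrite ltr0n.
have m0R : 0 < n.+1%:R :> R by rewrite ltr0n.
apply/andP; split.
  rewrite -[X in ln X]invf_div lnV ?posrE ?divr_gt0 // lerNr.
  have -> : n%:R / n.+1%:R = 1 + - n.+1%:R^-1 :> R.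
    by rewrite -natr1; field; rewrite natr1 gt_eqF.
  by apply: le_ln1Dx; rewrite ltrN2 invf_lt1 // ltr1n.
have -> : n.+1%:R / n%:R = 1 + n%:R^-1 :> R.
  by rewrite -natr1; field; rewrite gt_eqF.
by apply: le_ln1Dx; apply: lt_trans (_ : 0 < _); rewrite ?invr_gt0 // ltrN10.
Qed.

(* With u n = lnp (y / n), the differences u n ^+ j.+1 - u n.+1 ^+ j.+1 telescope
   and are comparable to j.+1 * u n ^+ j / n. *)
Lemma sum_lnp_div y j : 1 <= y ->
  0 <= \sum_(1 <= n < (Num.truncn y).+1) lnp (y / n%:R) ^+ j / n%:R
       - ln y ^+ j.+1 / j.+1%:R <= ln y ^+ j.
Proof.
move=> y1; have y0 : 0 < y by lra.
set M := Num.truncn y; pose u n := lnp (y / n%:R).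
have M0 : (0 < M)%N by rewrite truncn_gt0.
have u1 : u 1 = ln y by rewrite /u divr1 lnpE.
have uM : u M.+1 = 0.
  by apply: lnp_eq0; rewrite ler_pdivrMr ?ltr0n // mul1r ltW // truncnS_gt.
have j0 : 0 < j.+1%:R :> R by rewrite ltr0n.
(* The lower bound stops before [n = M]: there [y / n.+1 < 1], and truncation may shrink the
   difference. *)
have stepR n : (0 < n)%N -> 0 <= u n - u n.+1 <= n%:R^-1 /\
    ((n < M)%N -> n.+1%:R^-1 <= u n - u n.+1).
  move=> n0; have n0R : 0 < n%:R :> R by rewrite ltr0n.
  have := lnp_sub_div (divr_gt0 y0 n0R) (_ : 1 <= n.+1%:R / n%:R).
  rewrite ler_pdivlMr // mul1r ler_nat => /(_ (leqnSn n)).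
  have -> : y / n%:R / (n.+1%:R / n%:R) = y / n.+1%:R.
    by rewrite invf_div mulrA divfK ?gt_eqF.
  have /andP[l1 l2] := lnSn_bounds n0.
  rewrite -/(u n) -/(u n.+1) => /andP[v1 v2]; split; first by rewrite v1 (le_trans v2).
  rewrite truncn_gt_nat => ny; apply: le_trans l1 _.
  have ny' : n%:R <= y by apply: le_trans ny; rewrite ler_nat.
  rewrite /u !lnpE ?ler_pdivlMr ?mul1r ?ltr0n //.
  rewrite !ln_div ?posrE ?ltr0n //; lra.
have lb n : (0 < n)%N -> u n ^+ j.+1 - u n.+1 ^+ j.+1 <= j.+1%:R * (u n ^+ j / n%:R).
  move=> n0; have [/andP[d0 d1] _] := stepR n n0.
  have := @subrX_le (u n) (u n.+1) j; rewrite lnp_ge0 -subr_ge0 d0 => /(_ isT isT)/andP[_ h].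
  apply: le_trans h _; rewrite [leRHS]mulrA [leRHS]mulrC ler_wpM2r //.
  by rewrite mulr_ge0 ?exprn_ge0 ?lnp_ge0.
have ub n : (0 < n < M)%N -> j.+1%:R * (u n.+1 ^+ j / n.+1%:R) <= u n ^+ j.+1 - u n.+1 ^+ j.+1.
  move=> /andP[n0 nM]; have [/andP[d0 _] /(_ nM) d1] := stepR n n0.
  have := @subrX_le (u n) (u n.+1) j; rewrite lnp_ge0 -subr_ge0 d0 => /(_ isT isT)/andP[h _].
  apply: le_trans h; rewrite [leLHS]mulrA [leLHS]mulrC ler_wpM2r //.
  by rewrite mulr_ge0 ?exprn_ge0 ?lnp_ge0.
have tel a b (f : nat -> R) : (a <= b)%N -> \sum_(a <= n < b) (f n - f n.+1) = f a - f b.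
  move=> ab; rewrite -[RHS]opprB -telescope_sumr // -sumrN.
  by apply: eq_bigr => i _; rewrite opprB.
rewrite -u1; set S := \sum_(_ <= _ < _) _; apply/andP; split.
  rewrite subr_ge0 ler_pdivrMr // mulrC mulr_sumr.
  have -> : u 1 ^+ j.+1 = u 1 ^+ j.+1 - u M.+1 ^+ j.+1 by rewrite uM expr0n subr0.
  rewrite -(tel _ _ (fun n => u n ^+ j.+1)) //.
  by apply: ler_sum_nat => n /andP[n0 _]; apply: lb.
(* The term [n = 1] accounts for the whole error [ln y ^+ j]; each later term is compared with the
   difference that ends at its index. *)
rewrite lerBlDr /S big_nat_recl // -/(u 1) divr1 lerD2l ler_pdivlMr // mulrC mulr_sumr.
apply: le_trans (_ : \sum_(1 <= n < M) (u n ^+ j.+1 - u n.+1 ^+ j.+1) <= _).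
  by apply: ler_sum_nat => n nM; apply: ub.
by rewrite (tel _ _ (fun n => u n ^+ j.+1)) // gerBl exprn_ge0 // lnp_ge0.
Qed.

(** * Asymptotics of the number of tuples with bounded product *)

Lemma truncn_div y n : 0 <= y -> (0 < n)%N -> Num.truncn (y / n%:R) = (Num.truncn y %/ n)%N.
Proof.
move=> y0 n0; have n0R : 0 < n%:R :> R by rewrite ltr0n.
apply: truncn_def; rewrite ler_pdivlMr // ltr_pdivrMr // -!natrM.
rewrite -truncn_ge_nat // -truncn_lt_nat // leq_divM /=.
exact: ltn_ceil.
Qed.

Definition hypcount k y : R := (size (hyptuples k (Num.truncn y)))%:R.

Lemma hypcountS k y : 0 <= y ->
  hypcount k.+1 y = \sum_(1 <= n < (Num.truncn y).+1) hypcount k (y / n%:R).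
Proof.
move=> y0; rewrite /hypcount size_hyptuplesS natr_sum.
by apply: eq_big_nat => n /andP[n0 _]; rewrite truncn_div.
Qed.

Lemma harmonic_le y : 1 <= y ->
  \sum_(1 <= n < (Num.truncn y).+1) n%:R^-1 <= 1 + ln y.
Proof.
move=> /(sum_lnp_div 0); rewrite expr1 divr1 expr0 => /andP[_]; rewrite lerBlDr.
by apply: le_trans; apply: ler_sum => n _; rewrite expr0 div1r.
Qed.

(** The main terms at [y / n] add up to [y / j!] times the sum of [sum_lnp_div], whose error is at
    most [ln y ^+ j]; the factor 1 / j! is then bounded by 1. *)
Lemma hypcountS_err k j y : 1 <= y ->
  `|hypcount k.+1 y - y * ln y ^+ j.+1 / j.+1`!%:R| <=
  \sum_(1 <= n < (Num.truncn y).+1)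
    `|hypcount k (y / n%:R) - (y / n%:R) * ln (y / n%:R) ^+ j / j`!%:R|
  + y * ln y ^+ j.
Proof.
move=> y1; have y0 : 0 < y by lra.
have /andP[s0 s1] := sum_lnp_div j y1; set S := \sum_(_ <= _ < _) _ in s0 s1.
set T := ln y ^+ j.+1 / _ in s0 s1.
have jf : 1 <= j`!%:R :> R by rewrite ler1n fact_gt0.
have -> : hypcount k.+1 y - y * ln y ^+ j.+1 / j.+1`!%:R =
  \sum_(1 <= n < (Num.truncn y).+1)
    (hypcount k (y / n%:R) - (y / n%:R) * ln (y / n%:R) ^+ j / j`!%:R)
  + y / j`!%:R * (S - T).
  rewrite sumrB -hypcountS ?ltW // -addrA; congr (_ + _).
  rewrite mulrBr addrA /S mulr_sumr -sumrN -big_split /= big_nat big1 => [|n /andP[n1 nM]].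
    rewrite add0r /T factS natrM; congr (- _).
    by rewrite invfM; ring.
  have n0 : 0 < n%:R :> R by rewrite ltr0n.
  rewrite lnpE; last by rewrite ler_pdivlMr // mul1r -truncn_ge_nat // ltW.
  by field; rewrite !gt_eqF //; lra.
apply: le_trans (ler_normD _ _) _; apply: lerD; first exact: ler_norm_sum.
have yj : y / j`!%:R <= y by rewrite ler_pdivrMr ?ler_peMr ?(ltW y0) // (lt_le_trans _ jf).
rewrite ger0_norm; last by rewrite mulr_ge0 ?divr_ge0 // ltW.
by apply: ler_pM; rewrite ?divr_ge0 // ltW.
Qed.

(** In the induction the errors at [y / n] are at most [C * y * (1 + ln y) ^+ j / n], and the
    harmonic sum costs one more factor [1 + ln y]. With [ln y] alone the bound would fail at [y = 1]
    once [j > 0]. *)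
Lemma hypcount_asymp j : exists2 C : R, 0 <= C & forall y, 1 <= y ->
  `|hypcount j.+2 y - y * ln y ^+ j.+1 / j.+1`!%:R| <= C * (y * (1 + ln y) ^+ j).
Proof.
elim: j => [|j [C C0 IH]].
  (* For pairs, at most [y] rounding errors below 1 and the term [y * ln y ^+ 0] give 2. *)
  exists 2 => // y y1; apply: le_trans (hypcountS_err _ _ y1) _.
  have y0 : 0 < y by lra.
  rewrite expr0 !mulr1 (_ : 2 * y = y + y); last by ring.
  rewrite lerD2r; apply: le_trans (_ : \sum_(1 <= n < (Num.truncn y).+1) (1 : R) <= _).
    apply: ler_sum_nat => n /andP[n0 _]; rewrite /hypcount size_hyptuples1 mulr1 divr1.
    have /andP[t1 t2] : (Num.truncn (y / n%:R))%:R <= y / n%:R < (Num.truncn (y / n%:R)).+1%:R.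
      by apply: truncn_itv; rewrite divr_ge0 // ltW.
    by rewrite ler_norml; move: t2; rewrite -natr1; lra.
  by rewrite sumr_const_nat subn1 /= truncn_le ltW.
exists (C + 1) => [|y y1]; first lra.
have y0 : 0 < y by lra.
have l0 := ln_ge0 y1.
apply: le_trans (hypcountS_err _ _ y1) _; rewrite mulrDl mul1r; apply: lerD; last first.
  by rewrite ler_pM2l // lerXn2r // ?nnegrE; lra.
apply: le_trans (_ : \sum_(1 <= n < (Num.truncn y).+1) (C * y * (1 + ln y) ^+ j * n%:R^-1) <= _).
  apply: ler_sum_nat => n /andP[n0 nM].
  have n0R : 0 < n%:R :> R by rewrite ltr0n.
  have yn : 1 <= y / n%:R by rewrite ler_pdivlMr // mul1r -truncn_ge_nat // ltW.
  apply: le_trans (IH _ yn) _.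
  rewrite [leRHS](_ : _ = C * (y / n%:R * (1 + ln y) ^+ j)); last by ring.
  rewrite ler_wpM2l // ler_wpM2l ?divr_ge0 ?(ltW y0) // lerXn2r ?nnegrE ?addr_ge0 ?ln_ge0 //.
  rewrite lerD2l ler_ln ?posrE ?divr_gt0 // ler_pdivrMr // ler_peMr ?(ltW y0) //.
  by rewrite ler1n.
rewrite -mulr_sumr exprS [leRHS](_ : _ = C * y * (1 + ln y) ^+ j * (1 + ln y)); last by ring.
by rewrite ler_wpM2l ?harmonic_le // !mulr_ge0 ?exprn_ge0 ?addr_ge0 // ltW.
Qed.

(** * Numerical bounds for series over [e], and the zeta value *)

Lemma sum_ln_sqr M :
  \sum_(1 <= e < M.+1) ln (e%:R : R) / e%:R ^+ 2 <= 2.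
Proof.
case: M => [|M]; first by rewrite big_geq.
(* ln x / x ^ 2 has antiderivative - (ln x + 1) / x; the extra 1 / x makes the
   discrete differences large enough. *)
suff: \sum_(1 <= e < M.+2) ln (e%:R : R) / e%:R ^+ 2 <= 2 - (ln M.+1%:R + 2) / M.+1%:R.
  move=> /le_trans; apply; rewrite gerBl divr_ge0 ?addr_ge0 // ln_ge0 // ler1n //.
elim: M => [|M IH]; first by rewrite big_nat1 ln1; lra.
rewrite big_nat_recr //=.
have M0 : 0 < M.+1%:R :> R by rewrite ltr0n.
have /andP[_] := @lnSn_bounds M.+1 isT.
rewrite ln_div ?posrE ?ltr0n //; move: IH.
set a := ln M.+1%:R; set b := ln M.+2%:R.
have N1 : 1 <= M.+1%:R :> R by rewrite ler1n.
have b0 : 0 <= b by rewrite ln_ge0 // ler1n.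
have -> : M.+2%:R = M.+1%:R + 1 :> R by rewrite natr1.
move: (M.+1%:R : R) M0 N1 => N N0 N1.
move: (\sum_(_ <= _ < _) _) => S IH ba.
(* Since [N * (b - a) <= 1], the numerator of the difference is at least [a + 1], hence at least
   [b]. *)
have step : b / (N + 1) ^+ 2 <= (a + 2) / N - (b + 2) / (N + 1).
  have -> : (a + 2) / N - (b + 2) / (N + 1) = (a + 2 - N * (b - a)) / (N * (N + 1)).
    by field; rewrite !gt_eqF //; lra.
  have Nba : N * (b - a) <= 1 by rewrite mulrC -ler_pdivlMr // div1r.
  have Ni : N^-1 <= 1 by rewrite invf_le1.
  apply: ler_pM; rewrite ?invr_ge0 ?exprn_ge0 //; try lra.
  by rewrite lef_pV2 ?posrE ?mulr_gt0 ?exprn_gt0 //; nra.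
lra.
Qed.

(** A bound strictly below 1 is essential later. Telescoping 1 / (e - 1) - 1 / e from [e = 2] would
    only give 1, so the term 1 / 4 is kept exact and the rest telescopes to at most 1 / 2. *)
Lemma sum_inv_sqr M : \sum_(2 <= e < M.+1) (e%:R ^+ 2 : R)^-1 <= 3 / 4.
Proof.
case: M => [|[|M]]; try by rewrite big_geq //; lra.
suff: \sum_(2 <= e < M.+3) (e%:R ^+ 2 : R)^-1 <= 3 / 4 - M.+2%:R^-1.
  by move=> /le_trans; apply; rewrite gerBl invr_ge0.
elim: M => [|M IH]; first by rewrite big_nat1; lra.
rewrite big_nat_recr //=; apply: le_trans (lerD IH (lexx _)) _.
have M0 : 0 < M.+2%:R :> R by rewrite ltr0n.
have -> : M.+3%:R = M.+2%:R + 1 :> R by rewrite natr1.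
move: (M.+2%:R : R) M0 => N N0.
have : ((N + 1) ^+ 2)^-1 <= N^-1 - (N + 1)^-1.
  have -> : N^-1 - (N + 1)^-1 = (N * (N + 1))^-1.
    by field; rewrite !gt_eqF //; lra.
  by rewrite lef_pV2 ?posrE ?mulr_gt0 ?exprn_gt0 //; nra.
lra.
Qed.

Lemma invX_le_sqr k (e : nat) : (2 <= k)%N -> (0 < e)%N ->
  (e%:R ^+ k : R)^-1 <= (e%:R ^+ 2)^-1.
Proof.
move=> k2 e0; rewrite lef_pV2 ?posrE ?exprn_gt0 ?ltr0n //.
by rewrite ler_weXn2l // ler1n.
Qed.

Lemma zeta_partial_sum k :
  series (fun n => (n.+1%:R `^ (k%:R : R))^-1) =
  (fun M => \sum_(1 <= e < M.+1) (e%:R ^+ k)^-1).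
Proof.
apply/funext => M; rewrite /series /= big_add1 /=.
by apply: eq_bigr => e _; rewrite powR_mulrn.
Qed.

(** The partial sums increase and stay below 1 + 3 / 4, so the [limn] in [zeta] is a true limit. *)
Lemma zeta_cvg k : (2 <= k)%N ->
  \sum_(1 <= e < M.+1) (e%:R ^+ k)^-1 @[M --> \oo] --> zeta (k%:R : R).
Proof.
move=> k2; rewrite /zeta zeta_partial_sum.
apply: nondecreasing_is_cvgn.
  apply/nondecreasing_seqP => M; rewrite [leRHS]big_nat_recr //= lerDl.
  by rewrite invr_ge0 exprn_ge0.
exists 2 => _ [M _ <-].
case: M => [|M]; first by rewrite big_geq.
rewrite big_ltn // expr1n invr1.
have := sum_inv_sqr M.+1; suff : \sum_(2 <= e < M.+2) (e%:R ^+ k : R)^-1 <=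
   \sum_(2 <= e < M.+2) (e%:R ^+ 2)^-1 by lra.
by apply: ler_sum_nat => e /andP[e2 _]; apply: invX_le_sqr => //; apply: ltnW.
Qed.

Lemma zeta_ge1 k : (2 <= k)%N -> 1 <= zeta (k%:R : R).
Proof.
move=> k2; apply: cvgr_to_ge (zeta_cvg k2) _; exists 1%N => // -[//|M] _ /=.
rewrite big_ltn // expr1n invr1 lerDl; apply: sumr_ge0 => i _.
by rewrite invr_ge0 exprn_ge0.
Qed.

(** * Asymptotics of the number of primitive tuples *)

Definition primcount k y : R := (primtuples k (Num.truncn y))%:R.

Lemma primcount_eq0 k y : y < 1 -> primcount k y = 0.
Proof.
move=> y1; rewrite /primcount (_ : Num.truncn y = 0%N) ?primtuples0 //.
by apply/eqP; rewrite -leqn0 truncn_le_nat.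
Qed.

Lemma hypcount_primcount k y M : (0 < k)%N -> 0 <= y -> (Num.truncn y <= M)%N ->
  hypcount k y = \sum_(1 <= e < M.+1) primcount k (y / e%:R ^+ k).
Proof.
move=> k0 y0 yM; rewrite /hypcount -sum1_size natr_sum.
rewrite (sum_gcdseq (fun=> 1 : R) k0 yM); apply: eq_big_nat => e /andP[e0 _].
by rewrite /primcount -natrX truncn_div // expn_gt0 e0.
Qed.

Lemma lnpX_div_dist y (q : R) j : 1 <= y -> 1 <= q ->
  `|ln y ^+ j.+1 - lnp (y / q) ^+ j.+1| <= ln q * (j.+1%:R * ln y ^+ j).
Proof.
move=> y1 q1; have y0 : 0 < y by lra.
have /andP[] := lnp_sub_div y0 q1; rewrite (lnpE y1) subr_ge0 => v1 v2.
have /andP[l1 l2] := subrX_le j (lnp_ge0 (y / q)) v1.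
rewrite ger0_norm; last by apply: le_trans l1; rewrite !mulr_ge0 ?exprn_ge0 ?lnp_ge0 ?subr_ge0.
by apply: le_trans l2 _; rewrite ler_wpM2r // mulr_ge0 ?exprn_ge0 ?ln_ge0.
Qed.

Section PrimitiveTuples.
Variable j : nat.
Let k := j.+2.
Let c := ((j.+1)`!%:R * zeta (k%:R : R))^-1.
Let h y := primcount k y - c * (y * lnp y ^+ j.+1).

Let z0 : 0 < zeta (k%:R : R).
Proof. by apply: lt_le_trans (zeta_ge1 _). Qed.

Let c0 : 0 < c.
Proof. by rewrite invr_gt0 mulr_gt0 // ltr0n fact_gt0. Qed.

Let h_eq0 y : y < 1 -> h y = 0.
Proof.
by move=> y1; rewrite /h primcount_eq0 // lnp_eq0 ?ltW // expr0n !mulr0 subrr.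
Qed.

(** The condition on the partial zeta sum makes its truncation error, multiplied by
    [c * y * ln y ^+ j.+1], as small as the error allowed. *)
Lemma sum_primcount_err : exists2 C, 0 <= C & forall y M, 1 <= y ->
  (Num.truncn y <= M)%N ->
  `|zeta k%:R - \sum_(1 <= e < M.+1) (e%:R ^+ k)^-1| <= (1 + ln y)^-1 ->
  `|\sum_(1 <= e < M.+1) h (y / e%:R ^+ k)| <= C * (y * (1 + ln y) ^+ j).
Proof.
have [C C0 HC] := hypcount_asymp j.
(* The summands are for [hypcount_asymp], for the truncated zeta sum, and for replacing
   [lnp (y / e ^ k)] by [ln y]: there [ln (e ^ k) = k * ln e], and 2 is from [sum_ln_sqr]. *)
exists (C + c + c * (j.+1%:R * k%:R * 2)) => [|y M y1 yM zM].
  by rewrite !addr_ge0 ?mulr_ge0 // ltW.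
have y0 : 0 < y by lra.
have l0 := ln_ge0 y1.
set zs := \sum_(_ <= _ < _) _ in zM.
(* The identity rests on [c * zeta k = 1 / j.+1!], which cancels the main terms. *)
have -> : \sum_(1 <= e < M.+1) h (y / e%:R ^+ k) =
  (hypcount k y - y * ln y ^+ j.+1 / j.+1`!%:R) + c * y * ln y ^+ j.+1 * (zeta k%:R - zs)
  + c * y * \sum_(1 <= e < M.+1) (e%:R ^+ k)^-1 * (ln y ^+ j.+1 - lnp (y / e%:R ^+ k) ^+ j.+1).
  rewrite sumrB -hypcount_primcount ?(ltW y0) //.
  under [X in _ = _ + _ * X]eq_bigr do rewrite mulrBr.
  rewrite sumrB -mulr_suml -/zs -mulr_sumr.
  under [X in _ - c * X = _]eq_bigr do rewrite -mulrA.
  rewrite -mulr_sumr /c; field.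
  by rewrite !gt_eqF //= ltr0n fact_gt0.
rewrite !mulrDl; apply: le_trans (ler_normD _ _) _; apply: lerD.
  apply: le_trans (ler_normD _ _) _; apply: lerD; first exact: HC.
  rewrite normrM ger0_norm; last by rewrite !mulr_ge0 ?exprn_ge0 // ltW.
  apply: le_trans (ler_wpM2l _ zM) _; first by rewrite !mulr_ge0 ?exprn_ge0 // ltW.
  rewrite ler_pdivrMr; last by lra.
  rewrite [leRHS](_ : _ = c * y * (1 + ln y) ^+ j.+1); last by rewrite exprS; ring.
  by rewrite ler_wpM2l ?lerXn2r ?nnegrE ?mulr_ge0 ?(ltW y0) ?(ltW c0) //; lra.
rewrite normrM ger0_norm; last by rewrite mulr_ge0 // ltW.
rewrite [leRHS](_ : _ = c * y * (j.+1%:R * k%:R * (1 + ln y) ^+ j * 2)); last by ring.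
apply: ler_wpM2l; first by rewrite mulr_ge0 // ltW.
apply: le_trans (ler_norm_sum _ _ _) _.
apply: le_trans (_ : \sum_(1 <= e < M.+1)
  j.+1%:R * k%:R * (1 + ln y) ^+ j * (ln e%:R / e%:R ^+ 2) <= _); last first.
  by rewrite -mulr_sumr ler_wpM2l ?sum_ln_sqr // !mulr_ge0 ?exprn_ge0 //; lra.
apply: ler_sum_nat => e /andP[e0 _].
have e1 : 1 <= e%:R :> R by rewrite ler1n.
rewrite normrM ger0_norm ?invr_ge0 ?exprn_ge0 //.
have ek1 : 1 <= e%:R ^+ k :> R by rewrite exprn_ege1.
apply: le_trans (ler_wpM2l _ (lnpX_div_dist j y1 ek1)) _; first by rewrite invr_ge0 exprn_ge0.
rewrite lnXn ?ltr0n // -[ln _ *+ _]mulr_natr.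
rewrite [leLHS](_ : _ = j.+1%:R * k%:R * ln y ^+ j * (ln e%:R * (e%:R ^+ k)^-1)); last by ring.
apply: ler_pM; rewrite ?mulr_ge0 ?exprn_ge0 ?invr_ge0 ?exprn_ge0 ?ln_ge0 //.
  by rewrite ler_wpM2l ?lerXn2r ?nnegrE //; lra.
by rewrite ler_wpM2l ?ln_ge0 // invX_le_sqr.
Qed.

(* The term e = 1 of the sum bounded in sum_primcount_err is h y itself; by
   induction the others contribute at most a factor \sum_(e >= 2) e ^- 2 <= 3 / 4
   of the bound to be proved. *)
Lemma primcount_asymp : exists2 C, 0 <= C & forall y, 1 <= y ->
  `|h y| <= C * (y * (1 + ln y) ^+ j).
Proof.
have [C C0 HC] := sum_primcount_err.
(* The constant solves K = C + (3 / 4) K. The induction is on the integer part of [y], which drops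
   on dividing by [e ^ k] with [e >= 2]. *)
exists (4 * C) => [|y]; first lra.
have [n] := ubnP (Num.truncn y); elim: n y => // n IH y yn y1.
have y0 : 0 < y by lra.
have l0 := ln_ge0 y1.
have eps0 : 0 < (1 + ln y)^-1 by rewrite invr_gt0; lra.
have /cvgrPdist_le/(_ _ eps0)[N _ HN] := zeta_cvg (isT : (2 <= k)%N).
pose M := (N + (Num.truncn y).+1)%N.
have yM : (Num.truncn y <= M)%N by rewrite /M; lia.
have := HC y M y1 yM (HN M (leq_addr _ _)).
rewrite big_ltn ?expr1n ?divr1; last by rewrite /M; lia.
set w := y * (1 + ln y) ^+ j; set S := \sum_(_ <= _ < _) _ => hS.
suff : `|S| <= 3 * C * w.
  by have := lerB_normD (h y) S; lra.
apply: le_trans (ler_norm_sum _ _ _) _.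
apply: le_trans (_ : \sum_(2 <= e < M.+1) 4 * C * w * (e%:R ^+ 2)^-1 <= _); last first.
  rewrite -mulr_sumr [leRHS](_ : _ = 4 * C * w * (3 / 4)); last by field.
  by rewrite ler_wpM2l ?sum_inv_sqr // !mulr_ge0 ?exprn_ge0 ?addr_ge0 ?(ltW y0).
have w0 : 0 <= w by rewrite mulr_ge0 ?exprn_ge0 ?addr_ge0 ?(ltW y0).
apply: ler_sum_nat => e /andP[e2 _].
have e0 : (0 < e)%N by apply: ltnW.
have [lt1|ge1] := ltP (y / e%:R ^+ k) 1.
  rewrite h_eq0 // normr0; apply: mulr_ge0; last by rewrite invr_ge0 exprn_ge0.
    by apply: mulr_ge0 => //; lra.
have ek0 : (0 < e ^ k)%N by rewrite expn_gt0 e0.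
apply: le_trans (IH _ _ ge1) _.
  rewrite -natrX truncn_div ?(ltW y0) //.
  have : (Num.truncn y %/ e ^ k < Num.truncn y)%N.
    by rewrite ltn_Pdiv ?truncn_gt0 // -(exp1n k) ltn_exp2r.
  by move: yn; lia.
rewrite -[leRHS]mulrA; apply: ler_wpM2l; first lra.
rewrite /w [leRHS](_ : _ = y * (e%:R ^+ 2)^-1 * (1 + ln y) ^+ j); last by ring.
apply: ler_pM; rewrite ?exprn_ge0 ?addr_ge0 ?ln_ge0 //; first lra.
  by rewrite ler_wpM2l ?invX_le_sqr // ltW.
rewrite lerXn2r ?nnegrE ?addr_ge0 ?ln_ge0 // lerD2l ler_ln ?posrE //; last lra.
by rewrite ler_pdivrMr ?exprn_gt0 ?ltr0n // ler_peMr ?(ltW y0) // exprn_ege1 // ler1n.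
Qed.

(* The first bound gives domination, the second convergence to c for fixed q. *)
Lemma primcount_dist : exists A B : R, [/\ 0 <= A, 0 <= B &
  forall y q, 1 <= ln y -> 1 <= q ->
  `|q * primcount k (y / q) / (y * ln y ^+ j.+1) - c| <= Num.min (A + c) ((A + B * ln q) / ln y)].
Proof.
have [C C0 HC] := primcount_asymp.
(* The power of 2 comes from [1 + v <= 2 * ln y], valid as [1 <= ln y]; the second constant is from
   [lnpX_div_dist]. *)
exists (C * 2 ^+ j), (c * j.+1%:R); split; first by rewrite mulr_ge0 ?exprn_ge0.
  by rewrite mulr_ge0 // ltW.
move=> y q l1 q1.
have y1 : 1 <= y.
  by rewrite leNgt; apply/negP => /ltW/ln_le0; lra.
have [y0 q0] : 0 < y /\ 0 < q by lra.
have l0 : 0 < ln y by lra.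
set v := lnp (y / q).
have v0 : 0 <= v := lnp_ge0 _.
have vl : v <= ln y by have /andP[] := lnp_sub_div y0 q1; rewrite (lnpE y1) subr_ge0.
have hq : `|q * h (y / q)| <= C * 2 ^+ j * (y * ln y ^+ j).
  have [lt1|ge1] := ltP (y / q) 1.
    by rewrite h_eq0 // mulr0 normr0 !mulr_ge0 ?exprn_ge0 // ltW.
  rewrite normrM gtr0_norm //; apply: le_trans (ler_wpM2l (ltW q0) (HC _ ge1)) _.
  rewrite -(lnpE ge1) -/v [leLHS](_ : _ = C * (y * (1 + v) ^+ j)); last first.
    by field; rewrite gt_eqF.
  rewrite -[leRHS]mulrA ler_wpM2l // mulrCA ler_wpM2l ?(ltW y0) // -exprMn.
  by rewrite lerXn2r ?nnegrE; lra.
have E : q * primcount k (y / q) / (y * ln y ^+ j.+1) - c =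
   (q * h (y / q) - c * y * (ln y ^+ j.+1 - v ^+ j.+1)) / (y * ln y ^+ j.+1).
  by rewrite /h -/v; field; rewrite !gt_eqF // exprn_gt0.
have d0 : 0 < y * ln y ^+ j.+1 by rewrite mulr_gt0 ?exprn_gt0.
have cy : 0 <= c * y by rewrite mulr_ge0 ?ltW.
rewrite E normrM normfV [`|y * ln y ^+ _|]gtr0_norm // le_min.
(* The difference of powers is bounded by [ln y ^+ j.+1] for domination, and by [lnpX_div_dist] for
   convergence. *)
apply/andP; split; rewrite ler_pdivrMr //.
  rewrite [leRHS](_ : _ = C * 2 ^+ j * (y * ln y ^+ j.+1) + c * y * ln y ^+ j.+1); last by ring.
  apply: le_trans (ler_normB _ _) _; apply: lerD.
    apply: le_trans hq _; rewrite exprS; apply: ler_wpM2l; first by rewrite mulr_ge0 ?exprn_ge0.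
    by rewrite ler_wpM2l ?(ltW y0) // ler_peMl // exprn_ge0 // ltW.
  rewrite normrM ger0_norm // ler_wpM2l // ger0_norm ?subr_ge0 ?lerXn2r ?nnegrE ?(ltW l0) //.
  by rewrite gerBl exprn_ge0.
rewrite [leRHS](_ : _ =
  C * 2 ^+ j * (y * ln y ^+ j) + c * y * (ln q * (j.+1%:R * ln y ^+ j))); last first.
  by rewrite exprS; field; rewrite gt_eqF.
apply: le_trans (ler_normB _ _) _; apply: lerD => //.
by rewrite normrM ger0_norm // ler_wpM2l // lnpX_div_dist.
Qed.

End PrimitiveTuples.
End Analysis.

(** * Dominated convergence for series *)

(** Beyond [N] the bound [K] and the small tail of [a] suffice; the first [N] terms form a finite
    sum tending to 0. The estimate is uniform in [M], which may thus depend on [x]. *)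
Lemma tannery (R : realType) (T : Type) (F : set_system T) (FF : Filter F)
    (a : nat -> R) (w : T -> nat -> R) (K : R) :
  (forall n, 0 <= a n) -> cvgn (series a) ->
  (\forall x \near F, forall n, 0 <= w x n <= K) ->
  (forall n, w x n @[x --> F] --> 0) ->
  forall eps, 0 < eps ->
    \forall x \near F, forall M, \sum_(0 <= n < M) a n * w x n <= eps.
Proof.
move=> a0 cva wK w0 eps eps0.
have a_nd : {homo series a : n m / (n <= m)%N >-> n <= m}.
  by apply/nondecreasing_seqP => n; rewrite /series /= big_nat_recr //= lerDl.
have K0 : 0 < `|K| + 1 by rewrite ltr_wpDl.
have e2 : 0 < eps / 2 by lra.
have eK : 0 < eps / 2 / (`|K| + 1) by rewrite divr_gt0.
have /cvgrPdist_le/(_ _ eK)[N _ HN] := cva.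
have tail M : (N <= M)%N -> \sum_(N <= n < M) a n <= eps / 2 / (`|K| + 1).
  move=> NM; have -> : \sum_(N <= n < M) a n = series a M - series a N.
    by rewrite /series /= (big_cat_nat (leq0n N) NM) /= addrAC subrr add0r.
  have := HN N (leqnn N); have := nondecreasing_cvgn_le a_nd cva M.
  by rewrite ler_norml; lra.
have head : (fun x => \sum_(0 <= n < N) a n * w x n) @ F --> 0.
  elim: N {HN tail} => [|N IH].
    under eq_fun do rewrite big_geq //.
    exact: cvg_cst.
  under eq_fun do rewrite big_nat_recr //=.
  have : (fun x => a N * w x N) @ F --> a N * 0 by apply: cvgM => //; exact: cvg_cst.
  by move=> /(cvgD IH); rewrite mulr0 addr0.
have /cvgr0Pnorm_le/(_ _ e2) := head.
apply: filterS2 wK => x wK hx M.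
have w_ge0 n : 0 <= a n * w x n by rewrite mulr_ge0 // (andP (wK n)).1.
have wKK n : a n * w x n <= a n * (`|K| + 1).
  by rewrite ler_wpM2l //; have := (andP (wK n)).2; have := ler_norm K; lra.
(* Lengthening the sum makes the head complete even if [M < N]. *)
apply: le_trans (_ : \sum_(0 <= n < maxn N M) a n * w x n <= _).
  rewrite [leRHS](big_cat_nat (leq0n M)) ?leq_maxr //= lerDl.
  exact: sumr_ge0.
rewrite (big_cat_nat (leq0n N)) ?leq_maxl //=.
have : \sum_(N <= n < maxn N M) a n * w x n <= eps / 2.
  apply: le_trans (ler_sum _ (fun n _ => wKK n)) _.
  by rewrite -mulr_suml -ler_pdivlMr // tail // leq_maxl.
by have := le_trans (ler_norm _) hx; lra.
Qed.

(** * Absolute convergence of complex series *)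

Section ComplexSeries.
Variable R : realType.
Implicit Types (g : nat -> R[i]^o).

Lemma normcE_real (z : R[i]) : `|z| = (Normc.normc z)%:C.
Proof. by []. Qed.

Lemma normc_ge0 (z : R[i]) : 0 <= Normc.normc z.
Proof. by rewrite -ler0c -normcE_real. Qed.

(** Comparable complex numbers have equal imaginary parts, so the [eps] of a complex limit is
    real. *)
Lemma gt0_real (eps : R[i]) : 0 < eps -> exists2 e : R, 0 < e & eps = e%:C.
Proof.
move=> eps0; exists (complex.Re eps); last by rewrite RRe_real // gtr0_real.
by move: eps0; rewrite ltcE => /andP[].
Qed.

Lemma norm_le_ReIm (z : R[i]) : `|z| <= (`|complex.Re z| + `|complex.Im z|)%:C.
Proof.
rewrite {1}[z]complexE; apply: le_trans (ler_normD _ _) _.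
rewrite rmorphD /= lerD // ?normrM ?normc_def /= ?expr0n /= ?addr0 ?sqrtr_sqr //.
by rewrite expr1n add0r sqrtr1 mul1r.
Qed.

Lemma normc_ge_Im (z : R[i]) : `|complex.Im z|%:C <= `|z|.
Proof.
by rewrite normc_def lecR -sqrtr_sqr ler_wsqrtr // lerDr sqr_ge0.
Qed.

Lemma series_additive (U V : zmodType) (p : {additive U -> V}) (u : nat -> U) n :
  p (series u n) = series (p \o u) n.
Proof. exact: raddf_sum. Qed.

Lemma cvg_normc_series g : cvgn [normed series g] ->
  cvgn (series (fun n => Normc.normc (g n))).
Proof.
move=> /cvg_ex[l /cvgrPdist_le hl]; apply/cvg_ex; exists (complex.Re l).
apply/cvgrPdist_le => eps eps0.
have eps0' : 0 < eps%:C by rewrite ltcR.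
have := hl _ eps0'; apply: filterS => n; rewrite -lecR; apply: le_trans.
have -> : series (fun n => Normc.normc (g n)) n = complex.Re ([normed series g] n).
  by rewrite /series /= raddf_sum.
by rewrite -raddfB; exact: normc_ge_Re.
Qed.

(** The modulus dominates the real and imaginary parts, whose series thus converge absolutely in
    [R]. *)
Lemma cvg_complex_series g : cvgn (series (fun n => Normc.normc (g n))) -> cvgn (series g).
Proof.
move=> cg.
have part (p : {additive R[i] -> R}) :
    (forall z, `|p z| <= Normc.normc z) -> cvgn (series (p \o g)).
  move=> pn; apply: normed_cvg; apply: series_le_cvg cg => n //=; exact: normc_ge0.
have [] : cvgn (series (@complex.Re R \o g)) /\ cvgn (series (@complex.Im R \o g)).
  split; [apply: (part (@complex.Re R))|apply: (part (@complex.Im R))] => z;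
    rewrite -lecR -normcE_real.
    exact: normc_ge_Re.
  exact: normc_ge_Im.
move=> /cvg_ex[a /cvgrPdist_le ha] /cvg_ex[b /cvgrPdist_le hb]; apply/cvg_ex; exists (a +i* b).
apply/cvgrPdist_le => eps /gt0_real[e e0 ->].
have e2 : 0 < e / 2 by lra.
near=> n; apply: le_trans (norm_le_ReIm _) _; rewrite lecR.
rewrite !raddfB /= (series_additive (@complex.Re R)) (series_additive (@complex.Im R)).
rewrite (_ : e = e / 2 + e / 2); last by field.
apply: lerD; near: n; [exact: ha|exact: hb].
Unshelve. all: by end_near. Qed.

End ComplexSeries.

(** * Passage to the limit in the gcd sum *)

Lemma near_ge_ln (R : realType) (D : R) : \forall x \near +oo, D <= ln (x : R).
Proof.
exists (expR D); split; first exact: num_real.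
move=> x Dx; rewrite -[leLHS]expRK ler_ln ?posrE ?expR_gt0 ?(ltW Dx) //.
by apply: lt_trans Dx; exact: expR_gt0.
Qed.

Theorem theorem2p2 (R : realType) (f : nat -> R[i]^o) (k : nat) (hk : (2 <= k)%N)
    (hf : cvgn [normed series (fun n => f n.+1 / n.+1%:R ^+ k)]) :
  ((x * ln x ^+ k.-1)%:C^-1 * \sum_(n \in hyperbolic k x) f (gcd_tuple n) : R[i]^o)
    @[x --> +oo] -->
  (((k.-1)`!%:R * zeta (k%:R : R))%:C^-1 *
    limn (series (fun n => f n.+1 / n.+1%:R ^+ k)) : R[i]^o).
Proof.
move: hf; rewrite -(subnK hk) addn2; move: (k - 2)%N => {k hk} j hf.
have [A [B [A0 B0 HAB]]] := primcount_dist R j.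
(* With k = j.+2 left visible, simplification would unfold every x ^+ k. *)
move: (isT : (2 <= j.+2)%N) hf HAB; rewrite -[j.+2.-1]/j.+1.
move: j.+2 => k k2 hf; set c := _^-1 => HAB.
have c0 : 0 < c.
  by rewrite invr_gt0 mulr_gt0 ?ltr0n ?fact_gt0 // (lt_le_trans ltr01) // zeta_ge1.
set g := (fun n => f n.+1 / n.+1%:R ^+ k) in hf *.
have cvg_a := cvg_normc_series hf; have cvg_g := cvg_complex_series cvg_a.
pose q n : R := n.+1%:R ^+ k.
have q1 n : 1 <= q n by rewrite exprn_ege1 // ler1n.
pose W x n := q n * primcount k (x / q n) / (x * ln x ^+ j.+1).
pose w x n := `|W x n - c|.
have cancelE (F Q P Z : R[i]) : Q != 0 -> Z * (F * P) = F / Q * (Q * P * Z).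
  by move=> Q0; field.
(* Any long enough range represents the normalized sum as a weighted partial sum of the series of
   [g], with weights [W x n] tending to [c]. *)
have sumE x M : 1 <= ln x -> (Num.truncn x <= M)%N ->
    (x * ln x ^+ j.+1)%:C^-1 * \sum_(n \in hyperbolic k x) f (gcd_tuple n) =
    \sum_(0 <= n < M) g n * (W x n)%:C.
  move=> l1 xM.
  have x1 : 1 <= x by rewrite leNgt; apply/negP => /ltW/ln_le0; lra.
  rewrite fsum_hyperbolic (sum_gcdseq f (ltnW k2) xM) big_add1 /= mulr_sumr.
  apply: eq_bigr => n _; rewrite /g /W /primcount /q.
  have -> : Num.truncn (x / n.+1%:R ^+ k) = (Num.truncn x %/ n.+1 ^ k)%N.
    by rewrite -natrX truncn_div ?expn_gt0 //; lra.
  move: (primtuples _ _) => p.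
  rewrite -[f n.+1 *+ p]mulr_natr !rmorphM /= fmorphV !rmorphM /= !rmorph_nat /=.
  have -> : (n.+1%:R ^+ k : R)%:C = n.+1%:R ^+ k by rewrite rmorphXn /= rmorph_nat.
  by apply: cancelE; rewrite expf_neq0 // pnatr_eq0.
have wK : \forall x \near +oo, forall n, 0 <= w x n <= A + c.
  near=> x => n; rewrite normr_ge0 /=.
  apply: le_trans (HAB x (q n) _ (q1 n)) _; last by rewrite ge_min lexx.
  by near: x; exact: near_ge_ln.
have w0 n : w x n @[x --> +oo] --> 0.
  apply/cvgr0Pnorm_le => eps eps0; near=> x; rewrite normr_id.
  have l1 : 1 <= ln x by near: x; exact: near_ge_ln.
  apply: le_trans (HAB x (q n) l1 (q1 n)) _.
  rewrite ge_min; apply/orP; right.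
  rewrite ler_pdivrMr; last by lra.
  rewrite [eps * _]mulrC -ler_pdivrMr //.
  by near: x; exact: near_ge_ln.
apply/cvgrPdist_le => eps /gt0_real[e e0 ->].
have e2 : 0 < e / 2 by lra.
have hT := tannery _ (fun n => normc_ge0 (g n)) cvg_a wK w0 e2.
near=> x.
have l1 : 1 <= ln x by near: x; exact: near_ge_ln.
have hx : forall M, \sum_(0 <= n < M) Normc.normc (g n) * w x n <= e / 2.
  by near: x; exact: hT.
have ec0 : 0 < (e / 2 / c)%:C by rewrite ltcR divr_gt0.
have /cvgrPdist_le/(_ _ ec0)[N _ HN] := cvg_g.
(* The range covers all gcds and makes the remainder of the series small. *)
pose M := maxn N (Num.truncn x).
rewrite (sumE x M) ?leq_maxr //.
have -> : (j.+1`!%:R * zeta (k%:R : R))%:C^-1 = c%:C by rewrite -fmorphV.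
(* The first difference is the remainder of the series; the second is bounded by [hx]. *)
have -> : c%:C * limn (series g) - \sum_(0 <= n < M) g n * (W x n)%:C =
  c%:C * (limn (series g) - series g M) - \sum_(0 <= n < M) g n * (W x n - c)%:C.
  rewrite mulrBr /series /= mulr_sumr -addrA -opprD -big_split /=.
  congr (_ - _); apply: eq_bigr => n _; rewrite rmorphB /=; ring.
apply: le_trans (ler_normB _ _) _.
rewrite [leRHS](_ : _ = (e / 2)%:C + (e / 2)%:C); last by rewrite -rmorphD /= -splitr.
apply: lerD.
  rewrite normrM ger0_norm ?lecR ?(ltW c0) //.
  apply: le_trans (ler_wpM2l _ (HN M (leq_maxl _ _))) _; first by rewrite lecR ltW.
  by rewrite -rmorphM /= mulrC divfK // gt_eqF.
apply: le_trans (ler_norm_sum _ _ _) _.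
rewrite (le_trans _ (_ : (\sum_(0 <= n < M) Normc.normc (g n) * w x n)%:C <= _)) ?lecR //.
rewrite rmorph_sum /=; apply: ler_sum => n _.
rewrite normrM rmorphM /= normcE_real ler_wpM2l ?lecR ?normc_ge0 //.
by rewrite /w /= expr0n /= addr0 sqrtr_sqr.
Unshelve. all: by end_near. Qed.
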